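(* Let $\mathbb K$ be a field of characteristic $p>2$, $V_{\mathbb K}$ a vector space over $\mathbb K$, $n,r\ge1$. Let $(L_m)_{m=1}^n$ be a $p$-invariant discrete flat connection on $\mathbb Z^n\times V_{\mathbb K}\to\mathbb Z^n$, let $(\phi_l,\psi_m)$ be a $p$-invariant discrete flat connection on $\mathbb Z^{r+n}\times\mathbb K\to\mathbb Z^{r+n}$, and let $w,\ g_{l,m}:\mathbb Z^{r+n}\to V_{\mathbb K}$ be functions which together form an integral representation of $(L_m)$ with weight function $w$ (see context). Assume that $(\phi_l,\psi_m)$ is special, i.e. $\tilde\phi_l=1$ for $l=1,\dots,r$. Then the vector $$I(0)=\sum_{i_1,\dots,i_r=0}^{p-1}w(i_1e_1+\dots+i_re_r,0)\prod_{l=1}^r\prod_{d_l=0}^{i_l-1}\phi_l(i_1e_1+\dots+i_{l-1}e_{l-1}+d_le_l,0),$$ if nonzero, is an eigenvector of the $p$-curvature operators $C_m(0)$, $m=1,\dots,n$, with respective eigenvalues $\tilde\psi_m(0,0)$.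
   Context: $e_1,\dots,e_r$ and $f_1,\dots,f_n$ are the standard bases of $\mathbb Z^r$ and $\mathbb Z^n$; $\mathbb Z^{r+n}=\mathbb Z^r\times\mathbb Z^n\ni(j,k)$. A function on a lattice is $p$-periodic if it is invariant under shifts by $p$ times each standard basis vector. A $p$-invariant discrete flat connection on $\mathbb Z^n\times V_{\mathbb K}\to\mathbb Z^n$ is a collection of $p$-periodic functions $L_m:\mathbb Z^n\to\mathrm{GL}(V_{\mathbb K})$, $m=1,\dots,n$, with $L_i(k+f_j)L_j(k)=L_j(k+f_i)L_i(k)$ for all $i,j,k$. Its $p$-curvature functions are $C_m(k)=L_m(k+(p-1)f_m)\cdots L_m(k+f_m)L_m(k)$. A $p$-invariant discrete flat connection on $\mathbb Z^{r+n}\times\mathbb K\to\mathbb Z^{r+n}$ is a collection of $p$-periodic functions $\phi_l,\psi_m:\mathbb Z^{r+n}\to\mathbb K^\times$, $l=1,\dots,r$, $m=1,\dots,n$, with $\phi_l(j+e_i,k)\phi_i(j,k)=\phi_i(j+e_l,k)\phi_l(j,k)$, $\psi_m(j,k+f_i)\psi_i(j,k)=\psi_i(j,k+f_m)\psi_m(j,k)$, $\psi_m(j+e_i,k)\phi_i(j,k)=\phi_i(j,k+f_m)\psi_m(j,k)$ for all indices and all $(j,k)$. Its scalar $p$-curvature functions are $\tilde\phi_l(j,k)=\prod_{i=0}^{p-1}\phi_l(j+ie_l,k)$ and $\tilde\psi_m(j,k)=\prod_{i=0}^{p-1}\psi_m(j,k+if_m)$; they are constant in $(j,k)$. Integral representation: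 $w$ and $g_{l,m}$ ($l=1,\dots,r$, $m=1,\dots,n$) are $p$-periodic functions $\mathbb Z^{r+n}\to V_{\mathbb K}$ satisfying $$\psi_m(j,k)\,w(j,k+f_m)=L_m(k)w(j,k)+\sum_{l=1}^r\bigl(\phi_l(j,k)\,g_{l,m}(j+e_l,k)-g_{l,m}(j,k)\bigr)$$ for all $j\in\mathbb Z^r$, $k\in\mathbb Z^n$, $m=1,\dots,n$. *)

(* Defs.v *)
From mathcomp Require Import all_boot all_order all_algebra.

Set Implicit Arguments.
Unset Strict Implicit.
Unset Printing Implicit Defensive.

Import GRing.Theory.
Local Open Scope ring_scope.

Notation lattice d := 'rV[int]_d.

Definition std_basis (d : nat) (i : 'I_d) : lattice d := delta_mx 0 i.

Definition periodic (p d : nat) (T : Type) (f : lattice d -> T) : Prop :=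
  forall (i : 'I_d) (k : lattice d), f (k + std_basis i *+ p) = f k.

(* Functions on Z^(r+n) = Z^r x Z^n are curried. *)
Definition periodic2 (p r n : nat) (T : Type)
    (f : lattice r -> lattice n -> T) : Prop :=
  (forall k, periodic p (fun j => f j k)) /\ (forall j, periodic p (f j)).

(* V is an arbitrary, possibly infinite-dimensional, K-vector space, so an
   element of GL(V) is a bijective linear map; equality of such maps is
   pointwise. *)
Record flat_connection (p n : nat) (K : fieldType) (V : lmodType K)
    (L : 'I_n -> lattice n -> {linear V -> V}) : Prop := FlatConnection {
  flat_connection_bij : forall m k, bijective (L m k);
  flat_connection_per : forall m v, periodic p (fun k => L m k v);
  flat_connection_comm : forall i j k,
    L i (k + std_basis j) \o L j k =1 L j (k + std_basis i) \o L i k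
}.

(* L_m(k + (q-1) f_m) ... L_m(k + f_m) L_m(k) *)
Fixpoint transport (n : nat) (K : fieldType) (V : lmodType K)
    (L : 'I_n -> lattice n -> {linear V -> V}) (m : 'I_n) (k : lattice n)
    (q : nat) : {linear V -> V} :=
  if q is q'.+1
  then (L m (k + std_basis m *+ q') \o transport L m k q' : {linear V -> V})
  else (idfun : {linear V -> V}).

Definition p_curvature (p n : nat) (K : fieldType) (V : lmodType K)
    (L : 'I_n -> lattice n -> {linear V -> V}) (m : 'I_n) (k : lattice n) :
  {linear V -> V} := transport L m k p.

Record scalar_flat_connection (p r n : nat) (K : fieldType)
    (phi : 'I_r -> lattice r -> lattice n -> K)
    (psi : 'I_n -> lattice r -> lattice n -> K) : Prop :=
  ScalarFlatConnection {
  scalar_phi_neq0 : forall l j k, phi l j k != 0;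
  scalar_psi_neq0 : forall m j k, psi m j k != 0;
  scalar_phi_per : forall l, periodic2 p (phi l);
  scalar_psi_per : forall m, periodic2 p (psi m);
  scalar_phi_phi : forall l i j k,
    phi l (j + std_basis i) k * phi i j k
    = phi i (j + std_basis l) k * phi l j k;
  scalar_psi_psi : forall m i j k,
    psi m j (k + std_basis i) * psi i j k
    = psi i j (k + std_basis m) * psi m j k;
  scalar_psi_phi : forall m i j k,
    psi m (j + std_basis i) k * phi i j k
    = phi i j (k + std_basis m) * psi m j k
}.

Definition phi_curvature (p r n : nat) (K : fieldType)
    (phi : 'I_r -> lattice r -> lattice n -> K)
    (l : 'I_r) (j : lattice r) (k : lattice n) : K :=
  \prod_(0 <= i < p) phi l (j + std_basis l *+ i) k.

Definition psi_curvature (p r n : nat) (K : fieldType)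
    (psi : 'I_n -> lattice r -> lattice n -> K)
    (m : 'I_n) (j : lattice r) (k : lattice n) : K :=
  \prod_(0 <= i < p) psi m j (k + std_basis m *+ i).

Definition special (p r n : nat) (K : fieldType)
    (phi : 'I_r -> lattice r -> lattice n -> K) : Prop :=
  forall l j k, phi_curvature p phi l j k = 1.

Record integral_representation (p r n : nat) (K : fieldType) (V : lmodType K)
    (L : 'I_n -> lattice n -> {linear V -> V})
    (phi : 'I_r -> lattice r -> lattice n -> K)
    (psi : 'I_n -> lattice r -> lattice n -> K)
    (w : lattice r -> lattice n -> V)
    (g : 'I_r -> 'I_n -> lattice r -> lattice n -> V) : Prop :=
  IntegralRepresentation {
  integral_weight_per : periodic2 p w;
  integral_g_per : forall l m, periodic2 p (g l m);
  integral_eq : forall j k m,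
    psi m j k *: w j (k + std_basis m)
    = L m k (w j k)
      + \sum_(l < r) (phi l j k *: g l m (j + std_basis l) k - g l m j k)
}.

(* The sum runs over all multi-indices i = (i_1, ..., i_r) with
   0 <= i_l <= p - 1. *)
Definition I_vector (p r n : nat) (K : fieldType) (V : lmodType K)
    (phi : 'I_r -> lattice r -> lattice n -> K)
    (w : lattice r -> lattice n -> V) (k : lattice n) : V :=
  \sum_(i : {ffun 'I_r -> 'I_p})
    (\prod_(l < r) \prod_(0 <= d < i l)
        phi l (\sum_(s < r | (s < l)%N) std_basis s *+ i s
               + std_basis l *+ d) k)
    *: w (\sum_(s < r) std_basis s *+ i s) k.

Definition eigenvector (K : fieldType) (V : lmodType K)
    (f : {linear V -> V}) (a : K) (v : V) : Prop :=
  v != 0 /\ f v = a *: v.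

(* Main.v *)
(** Let W(j,k) be the product of the phi's along a lattice path from (0,k) to
    (j,k). Flatness gives W(j+e_l,k) = phi_l(j,k) W(j,k) and
    psi_m(j,k) W(j,k) = W(j,k+f_m) psi_m(0,k); speciality makes W(-,k)
    p-periodic. Multiplying the integral representation by W and summing over
    (Z/p)^r, the g-terms telescope, so psi_m(0,k) I(k+f_m) = L_m(k) I(k).
    Iterating p times and using I(k + p f_m) = I(k) gives the theorem. *)

Require Import Defs.
From mathcomp Require Import all_boot all_order all_algebra.

Set Implicit Arguments.
Unset Strict Implicit.
Unset Printing Implicit Defensive.

Import GRing.Theory.
Local Open Scope ring_scope.

(** A ladder of [q] commuting squares commutes as a whole: [A] and [A'] label the two rails and [B]
    the rungs. Below, the squares are flatness relations and one rail is a straight segment of a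
    path. *)
Lemma prod_intertwine (R : comNzRingType) (A A' B : nat -> R) (q : nat) :
  (forall d, A' d * B d = B d.+1 * A d) ->
  (\prod_(0 <= d < q) A' d) * B 0%N = B q * \prod_(0 <= d < q) A d.
Proof.
move=> AB; elim: q => [|q IHq]; first by rewrite !big_geq // mul1r mulr1.
rewrite !big_nat_recr //= mulrAC IHq [LHS]mulrC [LHS]mulrA AB -mulrA.
by congr (_ * _); rewrite mulrC.
Qed.

(* The corner c_0 e_0 + ... + c_(t-1) e_(t-1) of the staircase path to c. *)
Definition corner (r : nat) (c : 'I_r -> nat) (t : nat) : lattice r :=
  \sum_(s < r | (s < t)%N) std_basis s *+ c s.

(** The transport of [phi] along the first [t] segments of the staircase path to [c]. The cutoff [t]
    allows induction over the segments; coordinates are natural numbers rather than elements of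
    ['I_p], so that the value [p] can occur before reduction. *)
Definition weight (r n : nat) (K : fieldType)
    (phi : 'I_r -> lattice r -> lattice n -> K)
    (c : 'I_r -> nat) (t : nat) (k : lattice n) : K :=
  \prod_(l < r | (l < t)%N) \prod_(0 <= d < c l)
    phi l (corner c l + std_basis l *+ d) k.

Lemma ord_ltnSP (r : nat) (t s : 'I_r) :
  ((s < t.+1)%N && (s != t)) = (s < t)%N.
Proof. by rewrite ltnS andbC [RHS]ltn_neqAle. Qed.

Lemma corner0 (r : nat) (c : 'I_r -> nat) : corner c 0 = 0.
Proof. by rewrite /corner big_pred0. Qed.

Lemma cornerS (r : nat) (c : 'I_r -> nat) (t : 'I_r) :
  corner c t.+1 = corner c t + std_basis t *+ c t.
Proof.
rewrite /corner (bigD1 t) //= addrC; congr (_ + _).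
by apply: eq_bigl => s; rewrite ord_ltnSP.
Qed.

Lemma corner_full (r : nat) (c : 'I_r -> nat) :
  corner c r = \sum_(s < r) std_basis s *+ c s.
Proof. by apply: eq_bigl => s; rewrite ltn_ord. Qed.

Lemma eq_corner (r : nat) (c c' : 'I_r -> nat) (t : nat) :
  (forall s : 'I_r, (s < t)%N -> c s = c' s) -> corner c t = corner c' t.
Proof. by move=> cc'; apply: eq_bigr => s /cc' ->. Qed.

Lemma corner_step (r : nat) (c c' : 'I_r -> nat) (l : 'I_r) (t : nat) :
  (l < t)%N -> c' l = (c l).+1 -> (forall s, s != l -> c' s = c s) ->
  corner c' t = corner c t + std_basis l.
Proof.
move=> lt_lt c'l c's; rewrite /corner (bigD1 l) //= [in RHS](bigD1 l) //=.
rewrite c'l mulrS -addrA [RHS]addrC; congr (_ + (_ + _)).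
by apply: eq_bigr => s /andP[_ /c's ->].
Qed.

(** * Consequences of flatness and speciality for staircase weights *)

Section Weight.

Context (r n : nat) (K : fieldType) (phi : 'I_r -> lattice r -> lattice n -> K).
Implicit Types (c : 'I_r -> nat) (k : lattice n).

Lemma weight0 c k : weight phi c 0 k = 1.
Proof. by rewrite /weight big_pred0. Qed.

Lemma weightS c (t : 'I_r) k :
  weight phi c t.+1 k =
    weight phi c t k
    * \prod_(0 <= d < c t) phi t (corner c t + std_basis t *+ d) k.
Proof.
rewrite /weight (bigD1 t) //= mulrC; congr (_ * _).
by apply: eq_bigl => s; rewrite ord_ltnSP.
Qed.

Lemma weight_full c k :
  weight phi c r k =
    \prod_(l < r) \prod_(0 <= d < c l) phi l (corner c l + std_basis l *+ d) k.
Proof. by apply: eq_bigl => s; rewrite ltn_ord. Qed.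

Lemma eq_weight c c' (t : nat) k :
  (forall s : 'I_r, (s < t)%N -> c s = c' s) ->
  weight phi c t k = weight phi c' t k.
Proof.
move=> cc'; apply: eq_bigr => l lt; rewrite (cc' _ lt).
by rewrite (@eq_corner _ c c' l) // => s /ltn_trans sl; apply: cc'; apply: sl.
Qed.

(** The path to [c'] has one extra edge, at the end of segment [l]; flatness pushes that edge
    through all later segments to the endpoint. *)
Lemma weight_step c c' (l : 'I_r) k (t : nat) :
  (forall i j, phi i (j + std_basis l) k * phi l j k
               = phi l (j + std_basis i) k * phi i j k) ->
  c' l = (c l).+1 -> (forall s, s != l -> c' s = c s) ->
  (l < t <= r)%N ->
  weight phi c' t k = phi l (corner c t) k * weight phi c t k.
Proof.
move=> flat c'l c's; elim: t => // t IHt /andP[]; rewrite ltnS => lt tr.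
pose u := Ordinal tr; rewrite -[t]/(val u) !weightS cornerS.
move: lt; rewrite leq_eqVlt => /predU1P[/(@ord_inj _ l u) lu|lt].
  (* On segment [l] itself the extra edge is the last factor, located at the endpoint
     [corner c l.+1]. *)
  rewrite -lu c'l big_nat_recr //=.
  have eqc (s : 'I_r) : (s < l)%N -> c' s = c s.
    by move=> sl; apply: c's; rewrite neq_ltn sl.
  by rewrite (eq_corner eqc) (eq_weight _ eqc) mulrA mulrC.
rewrite c's; last by rewrite neq_ltn lt orbT.
have lt_t_r : (l < t <= r)%N by rewrite lt ltnW.
rewrite (IHt lt_t_r) (corner_step lt c'l c's).
(* Segment [u] comes after [l]: its copies for [c] and [c'] are parallel, at distance [std_basis l],
   and the values of [phi l] are the rungs between them. *)
pose B d := phi l (corner c t + std_basis u *+ d) k.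
have := @prod_intertwine _ (fun d => phi u (corner c t + std_basis u *+ d) k)
  (fun d => phi u (corner c t + std_basis l + std_basis u *+ d) k) B (c u).
rewrite /B mulr0n addr0 => BA.
rewrite mulrAC [X in X * _]mulrC BA.
  by rewrite -mulrA; congr (_ * _); rewrite mulrC.
by move=> d; rewrite addrAC flat mulrSr addrA.
Qed.

(** The whole staircase at [k] and its copy at [k + a] are the rails of a ladder with rungs [psi],
    so only the rungs at the two ends of the path remain. *)
Lemma weight_shift c (psi : lattice r -> lattice n -> K) k (a : lattice n)
    (t : nat) :
  (forall i j, psi (j + std_basis i) k * phi i j k
               = phi i j (k + a) * psi j k) ->
  (t <= r)%N ->
  psi (corner c t) k * weight phi c t k = weight phi c t (k + a) * psi 0 k.
Proof.
move=> flat; elim: t => [|t IHt] tr; first by rewrite corner0 !weight0 mulrC.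
pose u := Ordinal tr; rewrite -[t]/(val u) !weightS cornerS.
pose B d := psi (corner c t + std_basis u *+ d) k.
have := @prod_intertwine _ (fun d => phi u (corner c t + std_basis u *+ d) k)
  (fun d => phi u (corner c t + std_basis u *+ d) (k + a)) B (c u).
rewrite /B mulr0n addr0 => BA.
rewrite [X in _ * X]mulrC mulrA -BA; last first.
  by move=> d; rewrite -flat mulrSr addrA.
by rewrite -[LHS]mulrA [X in _ * X](IHt (ltnW tr)) [LHS]mulrCA mulrA.
Qed.

Lemma weight_period p c c' (l : 'I_r) k :
  (forall i j, phi i (j + std_basis l) k * phi l j k
               = phi l (j + std_basis i) k * phi i j k) ->
  (forall j, phi_curvature p phi l j k = 1) ->
  c l = 0%N -> c' l = p -> (forall s, s != l -> c' s = c s) ->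
  weight phi c' r k = weight phi c r k.
Proof.
(* [cq q] interpolates from [c] at [q = 0] to [c'] at [q = p]. Each step multiplies the weight by
   [phi l] at the current endpoint, and the [p] factors together form the curvature, which is 1. *)
move=> flat curv cl c'l c's; pose cq q := [eta c with l |-> q].
have cq_l q : cq q l = q by rewrite /= eqxx.
have cq_s q s : s != l -> cq q s = c s by move=> /= /negPf ->.
have cq_step q s : s != l -> cq q.+1 s = cq q s by move=> sl; rewrite !cq_s.
have c0 s : cq 0%N s = c s by rewrite /=; case: eqP => // ->.
have cp s : c' s = cq p s by rewrite /=; case: eqP => [->|/eqP /c's].
have corner_cq q : corner (cq q) r = corner c r + std_basis l *+ q.
  elim: q => [|q IHq]; first by rewrite addr0; apply: eq_corner => s _.
  rewrite (corner_step (ltn_ord l) _ (cq_step q)) ?cq_l // IHq.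
  by rewrite mulrSr addrA.
have weight_cq q : weight phi (cq q) r k =
    (\prod_(0 <= d < q) phi l (corner c r + std_basis l *+ d) k)
    * weight phi c r k.
  elim: q => [|q IHq].
    by rewrite big_geq // mul1r; apply: eq_weight => s _.
  rewrite (weight_step flat _ (cq_step q)) ?cq_l ?ltn_ord ?leqnn //.
  by rewrite IHq corner_cq big_nat_recr //= mulrA [in RHS](mulrC _ (phi _ _ _)).
rewrite (eq_weight k (fun s _ => cp s)) weight_cq.
by rewrite [X in X * _]curv mul1r.
Qed.

End Weight.

(** * Telescoping over the discrete torus *)

Definition cyclic_shift (p r : nat) (l : 'I_r) (i : {ffun 'I_r -> 'I_p}) :
  {ffun 'I_r -> 'I_p} := [ffun s => if s == l then ordS (i s) else i s].

Lemma cyclic_shift_inj (p r : nat) (l : 'I_r) : injective (@cyclic_shift p r l).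
Proof.
move=> i j /ffunP ij; apply/ffunP => s; have := ij s; rewrite !ffunE.
by case: ifP => // _ /(bij_inj (@ordS_bij p)).
Qed.

(** By [weight_step] each summand is the difference of weight times [h] between a point and its
    neighbour in direction [l]. This product is [p]-periodic in direction [l], so [cyclic_shift]
    reindexes one sum into the other. *)
Lemma sum_shift_telescope (p r n : nat) (K : fieldType) (V : lmodType K)
    (phi : 'I_r -> lattice r -> lattice n -> K) (l : 'I_r) (k : lattice n)
    (h : lattice r -> V) :
  (forall i j, phi i (j + std_basis l) k * phi l j k
               = phi l (j + std_basis i) k * phi i j k) ->
  (forall j, phi_curvature p phi l j k = 1) -> periodic p h ->
  \sum_(i : {ffun 'I_r -> 'I_p}) weight phi (fun s => i s) r k *:
    (phi l (corner (fun s => i s) r) k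
       *: h (corner (fun s => i s) r + std_basis l)
     - h (corner (fun s => i s) r)) = 0.
Proof.
move=> flat curv per_h.
under eq_bigr do rewrite scalerBr scalerA.
rewrite sumrB; apply/eqP; rewrite subr_eq0; apply/eqP.
rewrite [RHS](reindex_inj (@cyclic_shift_inj p r l)) /=.
apply: eq_bigr => i _.
have shift_s s : s != l -> cyclic_shift l i s = i s.
  by move=> /negPf sl; rewrite ffunE sl.
have shift_l : cyclic_shift l i l = ((i l).+1 %% p)%N :> nat by rewrite ffunE eqxx.
(* [c1] is the neighbour of [c] before reduction modulo [p], and [c'] the one after; they differ
   only when coordinate [l] wraps around. *)
pose c s := (i s : nat); pose c' s := (cyclic_shift l i s : nat).
pose c1 s := (i s + (s == l))%N.
have c1_l : c1 l = (c l).+1 by rewrite /c1 eqxx addn1.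
have c1_s s : s != l -> c1 s = c s by rewrite /c1 => /negPf ->; rewrite addn0.
have <- : weight phi c1 r k = weight phi c r k * phi l (corner c r) k.
  by rewrite (weight_step flat c1_l c1_s) ?ltn_ord ?leqnn // mulrC.
rewrite -/c -(corner_step (ltn_ord l) c1_l c1_s).
have [lt_ip|le_pi] := ltnP (i l).+1 p.
  have c1E s : c1 s = c' s.
    have [->|sl] := eqVneq s l; first by rewrite c1_l /c' shift_l modn_small.
    by rewrite c1_s // /c' shift_s.
  by rewrite (eq_weight phi k (fun s _ => c1E s)) (eq_corner (fun s _ => c1E s)).
(* Wrap-around: coordinate [l] is [p] in [c1] and 0 in [c']. Speciality equates the weights, and
   periodicity of [h] absorbs the displacement of the endpoint. *)
have ip : (i l).+1 = p by apply/eqP; rewrite eqn_leq le_pi ltn_ord.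
have c'_l : c' l = 0%N by rewrite /c' shift_l ip modnn.
have c1_s' s : s != l -> c1 s = c' s by move=> sl; rewrite c1_s // /c' shift_s.
have c1_lp : c1 l = p by rewrite c1_l.
rewrite (weight_period flat curv c'_l c1_lp c1_s').
suff -> : corner c1 r = corner c' r + std_basis l *+ p by rewrite per_h.
rewrite !corner_full (bigD1 l) //= [in RHS](bigD1 l) //=.
rewrite c1_lp c'_l mulr0n add0r addrC.
by congr (_ + _); apply: eq_bigr => s /c1_s' ->.
Qed.

(** * Dependence of the vector I(k) on k *)

Lemma I_vectorE (p r n : nat) (K : fieldType) (V : lmodType K)
    (phi : 'I_r -> lattice r -> lattice n -> K)
    (w : lattice r -> lattice n -> V) (k : lattice n) :
  I_vector p phi w k = \sum_(i : {ffun 'I_r -> 'I_p})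
    weight phi (fun s => i s) r k *: w (corner (fun s => i s) r) k.
Proof. by apply: eq_bigr => i _; rewrite corner_full weight_full. Qed.

Lemma I_vector_shift (p r n : nat) (K : fieldType) (V : lmodType K)
    (L : 'I_n -> lattice n -> {linear V -> V})
    (phi : 'I_r -> lattice r -> lattice n -> K)
    (psi : 'I_n -> lattice r -> lattice n -> K)
    (w : lattice r -> lattice n -> V)
    (g : 'I_r -> 'I_n -> lattice r -> lattice n -> V)
    (hphipsi : scalar_flat_connection p phi psi)
    (hw : integral_representation p L phi psi w g)
    (hspecial : special p phi) (m : 'I_n) (k : lattice n) :
  psi m 0 k *: I_vector p phi w (k + std_basis m) = L m k (I_vector p phi w k).
Proof.
rewrite !I_vectorE scaler_sumr linear_sum /=.
(* [weight_shift] trades [psi] at the origin for [psi] at each summand's own corner, which is where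
   the integral representation applies. *)
under eq_bigr => i _ do rewrite scalerA [psi m 0 k * _]mulrC
  -(weight_shift _ (fun l j => scalar_psi_phi hphipsi m l j k) (leqnn r))
  mulrC -scalerA (integral_eq hw) scalerDr scaler_sumr.
rewrite big_split /= exchange_big /= [X in _ + X]big1 ?addr0; last first.
  move=> l _; apply: (@sum_shift_telescope _ _ _ _ _ _ _ _ (fun j => g l m j k)).
  - by move=> i j; exact: scalar_phi_phi hphipsi i l j k.
  - by move=> j; exact: hspecial.
  - exact: (integral_g_per hw l m).1.
by apply: eq_bigr => i _; rewrite linearZ.
Qed.

Lemma I_vector_transport (p r n : nat) (K : fieldType) (V : lmodType K)
    (L : 'I_n -> lattice n -> {linear V -> V})
    (phi : 'I_r -> lattice r -> lattice n -> K)
    (psi : 'I_n -> lattice r -> lattice n -> K)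
    (w : lattice r -> lattice n -> V)
    (g : 'I_r -> 'I_n -> lattice r -> lattice n -> V)
    (hphipsi : scalar_flat_connection p phi psi)
    (hw : integral_representation p L phi psi w g)
    (hspecial : special p phi) (m : 'I_n) (k : lattice n) (q : nat) :
  transport L m k q (I_vector p phi w k) =
    (\prod_(0 <= i < q) psi m 0 (k + std_basis m *+ i))
    *: I_vector p phi w (k + std_basis m *+ q).
Proof.
elim: q => [|q IHq]; first by rewrite big_geq // scale1r addr0.
rewrite /= IHq linearZ /= -(I_vector_shift hphipsi hw hspecial) scalerA.
by rewrite big_nat_recr //= mulrSr addrA.
Qed.

Lemma I_vector_periodic (p r n : nat) (K : fieldType) (V : lmodType K)
    (phi : 'I_r -> lattice r -> lattice n -> K)
    (w : lattice r -> lattice n -> V) :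
  (forall l, periodic2 p (phi l)) -> periodic2 p w ->
  periodic p (I_vector p phi w).
Proof.
move=> per_phi per_w m k; apply: eq_bigr => i _; rewrite per_w.2.
by congr (_ *: _); do 2![apply: eq_bigr => ? _]; rewrite (per_phi _).2.
Qed.

Theorem corollary3p5 (p r n : nat) (K : fieldType) (V : lmodType K)
  (L : 'I_n -> lattice n -> {linear V -> V})
  (phi : 'I_r -> lattice r -> lattice n -> K)
  (psi : 'I_n -> lattice r -> lattice n -> K)
  (w : lattice r -> lattice n -> V)
  (g : 'I_r -> 'I_n -> lattice r -> lattice n -> V)
  (hchar : p \in [pchar K]) (hp : (2 < p)%N)
  (hr : (1 <= r)%N) (hn : (1 <= n)%N)
  (hL : flat_connection p L)
  (hphipsi : scalar_flat_connection p phi psi)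
  (hw : integral_representation p L phi psi w g)
  (hspecial : special p phi) :
  I_vector p phi w 0 != 0 ->
  forall m : 'I_n,
    eigenvector (p_curvature p L m 0) (psi_curvature p psi m 0 0)
      (I_vector p phi w 0).
Proof.
move=> nzI m; split=> //.
rewrite /p_curvature (I_vector_transport hphipsi hw hspecial).
(* After [p] steps the scalar is already [psi_curvature] at the origin, and periodicity in k returns
   the transported vector to its starting point. *)
by rewrite (I_vector_periodic (scalar_phi_per hphipsi) (integral_weight_per hw)).
Qed.
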